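(* Let $q\ge 1$ and let $A=(a_1,\ldots,a_q)$, $B=(b_1,\ldots,b_q)$ be parameter vectors with no $b_j$ in $\{0,-1,-2,\ldots\}$. Suppose that $$\frac{e_q(b_1,\ldots,b_q)}{e_q(a_1,\ldots,a_q)}\ge\frac{e_{q-1}(b_1,\ldots,b_q)}{e_{q-1}(a_1,\ldots,a_q)}\ge\cdots\ge\frac{e_1(b_1,\ldots,b_q)}{e_1(a_1,\ldots,a_q)}\ge 1$$ and that each elementary symmetric polynomial in this chain is nonnegative (the denominators being nonzero). Then, with $f_1=\prod_{i=1}^{q}(a_i/b_i)$, $$e^{f_1x}\le{}_qF_q(A;B;x)\le 1-f_1+f_1e^x\quad\text{for all } x\ge 0.$$ Moreover, the upper bound remains true if the chain of inequalities is replaced by the weaker requirement that each of the fractions $e_k(b_1,\ldots,b_q)/e_k(a_1,\ldots,a_q)$, $k=1,\ldots,q$, is not less than $1$.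
   Context: ${}_qF_q(A;B;x)=\sum_{n\ge 0}\frac{(a_1)_n\cdots(a_q)_n}{(b_1)_n\cdots(b_q)_n\,n!}x^n$, where $(a)_0=1$, $(a)_n=a(a+1)\cdots(a+n-1)$. The parameter vectors are in general complex. The elementary symmetric polynomials are $e_k(x_1,\ldots,x_q)=\sum_{1\le j_1<j_2<\cdots<j_k\le q}x_{j_1}x_{j_2}\cdots x_{j_k}$, $k=1,\ldots,q$; ''nonnegative'' means real and $\ge0$. *)

(* Defs.v *)
From mathcomp Require Import all_boot all_order all_algebra.
From mathcomp Require Import all_classical all_reals all_analysis.
From mathcomp Require Import complex.

Set Implicit Arguments.
Unset Strict Implicit.
Unset Printing Implicit Defensive.

Import Order.TTheory GRing.Theory Num.Theory numFieldNormedType.Exports.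

Local Open Scope ring_scope.
Local Open Scope complex_scope.

(* The order of [R[i]] is partial: [z <= w] means [Im z = Im w] and
   [Re z <= Re w], so [0 <= z] says that [z] is real and nonnegative. *)

Definition elsym (R : realType) (q k : nat) (v : 'I_q -> R[i]) : R[i] :=
  \sum_(S : {set 'I_q} | #|S| == k) \prod_(j in S) v j.

Definition pochhammer (R : realType) (a : R[i]) (n : nat) : R[i] :=
  \prod_(m < n) (a + m%:R).

Definition hyp_term (R : realType) (q : nat) (A B : 'I_q -> R[i])
    (z : R[i]) (n : nat) : R[i] :=
  (\prod_(j < q) pochhammer (A j) n) /
  ((\prod_(j < q) pochhammer (B j) n) * (n`!)%:R) * z ^+ n.

(* [R[i]^o] carries the topology of the complex modulus; it is convertible
   to [R[i]], which has no topological structure of its own in the library. *)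
Definition hyperF (R : realType) (q : nat) (A B : 'I_q -> R[i])
    (z : R[i]) : R[i] :=
  limn (series (hyp_term A B z : nat -> R[i]^o)).

Definition cexp (R : realType) (z : R[i]) : R[i] :=
  (expR (complex.Re z))%:C *
  (cos (complex.Im z) +i* sin (complex.Im z)).

(* Main.v *)
(** Since [\prod_j (v j + m)] is [\sum_k e_k(v) m^(q-k)], comparing the
    elementary symmetric polynomials of [A] and [B] coefficientwise bounds each
    term ratio [rho m = \prod_j (A j + m) / (B j + m)]: fractions at least [1]
    give [rho m <= 1], and all fractions at most [e_q(B) / e_q(A)] give
    [rho 0 <= rho m].  As [rho 0 = f1], the coefficient of [x^n / n!], namely
    [\prod_(m < n) rho m], is at most [f1] for [n >= 1] in the first case, and
    at least [f1 ^ n] in the second; it remains to sum the exponential series. *)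

Require Import Defs.
From mathcomp Require Import all_boot all_order all_algebra.
From mathcomp Require Import all_classical all_reals all_analysis.
From mathcomp Require Import complex.
Import Order.TTheory GRing.Theory Num.Theory numFieldNormedType.Exports.

Local Open Scope ring_scope.
Local Open Scope complex_scope.

Lemma elsym0 (R : realType) (q : nat) (v : 'I_q -> R[i]) : elsym 0 v = 1.
Proof.
rewrite /elsym (big_pred1 finset.set0); first by rewrite big_set0.
by move=> S /=; rewrite cards_eq0.
Qed.

Lemma elsym_full (R : realType) (q : nat) (v : 'I_q -> R[i]) :
  elsym q v = \prod_(j < q) v j.
Proof.
rewrite /elsym (big_pred1 [set: 'I_q]%SET); last first.
  move=> S /=; rewrite eqEcard finset.subsetT cardsT card_ord eqn_leq.
  by rewrite -[X in (_ <= X)%N && _](card_ord q) max_card.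
by apply: eq_bigl => j; rewrite finset.in_setT.
Qed.

(** Distributivity yields one summand per set [S] of indices at which [v j] is chosen; the other
    [q - #|S|] factors contribute [z]. Grouping the sets by cardinality gives the coefficients. *)
Lemma prod_addr_elsym (R : realType) (q : nat) (v : 'I_q -> R[i]) (z : R[i]) :
  \prod_(j < q) (v j + z) = \sum_(k < q.+1) elsym k v * z ^+ (q - k).
Proof.
rewrite bigA_distr /=.
(* As [#|S| <= q], [inord] never falls back on its default value here. *)
rewrite (partition_big (fun S : {set 'I_q} => inord #|S| : 'I_q.+1) predT) //=.
apply: eq_bigr => k _; rewrite /elsym big_distrl /=.
have cardS (S : {set 'I_q}) : (#|S| <= q)%N.
  by rewrite (leq_trans (max_card _)) ?card_ord.
apply: eq_big => [S | S /eqP Sk].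
  by rewrite -val_eqE /= inordK // ltnS.
have {}Sk : #|S| = k by rewrite -Sk inordK // ltnS.
rewrite (bigID (mem S)) /=; congr (_ * _).
  by apply: eq_bigr => j ->.
rewrite (eq_bigr (fun=> z)); last by move=> j /negbTE ->.
rewrite prodr_const; congr (_ ^+ _).
by rewrite -[X in (X - _)%N](card_ord q) -(cardC (mem S)) Sk addKn.
Qed.

Definition term_ratio {R : realType} {q : nat} (A B : 'I_q -> R[i]) (m : nat) :=
  \prod_(j < q) ((A j + m%:R) / (B j + m%:R)).

Lemma hyp_termE (R : realType) (q : nat) (A B : 'I_q -> R[i]) (z : R[i]) n :
  hyp_term A B z n = (\prod_(m < n) term_ratio A B m) * (z ^+ n / n`!%:R).
Proof.
rewrite /hyp_term /term_ratio /pochhammer exchange_big /=.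
rewrite [X in _ / (X * _)]exchange_big /=.
under [in RHS]eq_bigr do rewrite prodf_div.
by rewrite prodf_div invfM !mulrA [RHS]mulrAC.
Qed.

Section TermRatio.
Variables (R : realType) (q : nat) (A B : 'I_q -> R[i]).
Hypothesis B_ok : forall (j : 'I_q) (n : nat), B j != - n%:R.
Hypothesis eA_ge0 : forall k : nat, (k <= q)%N -> 0 <= elsym k A.
Hypothesis eB_ge0 : forall k : nat, (k <= q)%N -> 0 <= elsym k B.

Let prod_addr_ge0 (v : 'I_q -> R[i]) (m : nat) :
  (forall k : nat, (k <= q)%N -> 0 <= elsym k v) ->
  0 <= \prod_(j < q) (v j + m%:R).
Proof.
move=> v_ge0; rewrite prod_addr_elsym sumr_ge0// => k _.
by rewrite mulr_ge0 ?exprn_ge0 ?ler0n ?v_ge0 // -ltnS.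
Qed.

(** Single factors may be non-real: the sign comes from the expansion of the whole product, and
    [B_ok] only excludes zero. *)
Let prod_addr_gt0 (m : nat) : 0 < \prod_(j < q) (B j + m%:R).
Proof.
rewrite lt_def prod_addr_ge0// andbT; apply/prodf_neq0 => j _.
by rewrite addr_eq0.
Qed.

Lemma term_ratio_ge0 m : 0 <= term_ratio A B m.
Proof. by rewrite /term_ratio prodf_div divr_ge0// ?prod_addr_ge0// ltW. Qed.

Lemma term_ratio_le1 m :
  (forall k : nat, (k <= q)%N -> elsym k A <= elsym k B) ->
  term_ratio A B m <= 1.
Proof.
move=> le_eAB; rewrite /term_ratio prodf_div ler_pdivrMr// mul1r.
rewrite !prod_addr_elsym ler_sum// => k _.
by rewrite ler_wpM2r ?exprn_ge0 ?ler0n ?le_eAB// -ltnS.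
Qed.

(** Since [term_ratio A B 0] is [elsym q A / elsym q B], clearing denominators leaves two
    polynomials in [m] with nonnegative coefficients, and the hypothesis compares these one by
    one. *)
Lemma term_ratio_ge_first m :
  (forall k : nat, (k <= q)%N ->
     elsym q A * elsym k B <= elsym q B * elsym k A) ->
  term_ratio A B 0 <= term_ratio A B m.
Proof.
move=> le_eAB; rewrite /term_ratio !prodf_div.
rewrite ler_pdivlMr// mulrAC ler_pdivrMr//.
under eq_bigr do rewrite addr0.
under [X in _ <= _ * X]eq_bigr do rewrite addr0.
rewrite -(elsym_full _ _ A) -(elsym_full _ _ B) !prod_addr_elsym mulrC [leRHS]mulrC.
rewrite [leLHS]mulrC !big_distrr /= ler_sum// => k _.
by rewrite !mulrA ler_wpM2r ?exprn_ge0 ?ler0n ?le_eAB// -ltnS.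
Qed.

End TermRatio.

Lemma cvg_real_complex (R : realType) (u : nat -> R) (l : R) :
  (u @ \oo --> l)%classic ->
  ((fun n => (u n)%:C : R[i]^o) @ \oo --> (l%:C : R[i]^o))%classic.
Proof.
move=> /cvgrPdist_lt ul; apply/cvgrPdist_lt => e e0.
(* A positive element of [R[i]] is real, so the radius [e] can be used in [R]. *)
have eE : e = (complex.Re e)%:C by rewrite RRe_real ?gtr0_real.
have {}e0 : 0 < complex.Re e by rewrite -ltcR -eE.
apply: filterS (ul _ e0) => n; rewrite eE -ltcR => /le_lt_trans; apply.
by rewrite -rmorphB /= normc_def /= expr0n addr0 sqrtr_sqr.
Qed.

Lemma lim_series_complex (R : realType) (u : nat -> R) (t : nat -> R[i]) :
  cvgn (series u) -> (forall n, t n = (u n)%:C) ->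
  limn (series (t : nat -> R[i]^o)) = (limn (series u))%:C.
Proof.
move=> cu tE; apply: cvg_lim; first exact: norm_hausdorff.
have -> : series (t : nat -> R[i]^o) = (fun n => (series u n)%:C).
  apply/funext => n; rewrite /series /= rmorph_sum /=.
  by apply: eq_bigr => k _; rewrite tE.
exact: cvg_real_complex.
Qed.

Section RealSeries.
Variables (R : realType) (r : nat -> R) (x : R).
Hypothesis r_ge0 : forall m, 0 <= r m.
Hypothesis r_le1 : forall m, r m <= 1.
Hypothesis x_ge0 : 0 <= x.

Let u n := (\prod_(m < n) r m) * exp_coeff x n.

Let coeff_ge0 n : 0 <= exp_coeff x n.
Proof. exact: exp_coeff_ge0. Qed.

Lemma cvg_series_ratio : cvgn (series u).
Proof.
apply: (@series_le_cvg _ _ (exp_coeff x)) => // [n|n|].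
- by rewrite mulr_ge0 ?prodr_ge0.
- by rewrite ler_piMl// prodr_ile1// => m _; rewrite r_ge0 r_le1.
- exact: is_cvg_series_exp_coeff.
Qed.

Lemma lim_series_ratio_le : limn (series u) <= 1 - r 0 + r 0 * expR x.
Proof.
have cvg_bound : ((fun n => 1 - r 0 + r 0 * series (exp_coeff x) n) @ \oo
    --> 1 - r 0 + r 0 * expR x)%classic.
  apply: cvgD; first exact: cvg_cst.
  by apply: cvgM; [exact: cvg_cst | exact: is_cvg_series_exp_coeff].
rewrite -(cvg_lim _ cvg_bound)//; apply: ler_lim.
- exact: cvg_series_ratio.
- by apply/cvg_ex; eexists; exact: cvg_bound.
(* The bound holds for every partial sum. The empty sum needs [r 0 <= 1], and with one term both
   sides equal [1]. In each later term the factor [r 0] splits off and the remaining factors are at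
   most [1]. *)
apply: nearW; elim=> [|n IHn].
  by rewrite /series /= !big_geq// mulr0 addr0 subr_ge0.
case: n => [|n] in IHn *.
  rewrite /series /= !big_nat1 /u big_ord0 /exp_coeff /= expr0 fact0 divr1.
  by rewrite !mulr1 subrK.
rewrite ![series _ n.+2]seriesSr mulrDr addrA lerD// /u ler_wpM2r// big_ord_recl /=.
by rewrite ler_piMr// prodr_ile1// => m _; rewrite r_ge0 r_le1.
Qed.

Lemma lim_series_ratio_ge :
  (forall m, r 0 <= r m) -> expR (r 0 * x) <= limn (series u).
Proof.
move=> r_ge; apply: ler_lim.
- exact: is_cvg_series_exp_coeff.
- exact: cvg_series_ratio.
apply: nearW => n; rewrite /series /= ler_sum// => k _.
rewrite /exp_coeff /= exprMn -mulrA ler_wpM2r//; first exact: coeff_ge0.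
rewrite -[k in _ ^+ k]card_ord -prodr_const ler_prod// => m _.
by rewrite r_ge0 r_ge.
Qed.

End RealSeries.

Theorem theorem7 (R : realType) (q : nat) (A B : 'I_q -> R[i])
  (q_ge1 : (1 <= q)%N)
  (B_ok : forall (j : 'I_q) (n : nat), B j != - n%:R)
  (eA_ge0 : forall k : nat, (1 <= k <= q)%N -> 0 <= elsym k A)
  (eB_ge0 : forall k : nat, (1 <= k <= q)%N -> 0 <= elsym k B)
  (eA_neq0 : forall k : nat, (1 <= k <= q)%N -> elsym k A != 0) :
  let f1 : R[i] := \prod_(j < q) (A j / B j) in
  ((forall k : nat, (1 <= k < q)%N ->
      elsym k B / elsym k A <= elsym k.+1 B / elsym k.+1 A) ->
   1 <= elsym 1 B / elsym 1 A ->
   forall x : R, 0 <= x ->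
     cexp (f1 * x%:C) <= hyperF A B x%:C /\
     hyperF A B x%:C <= 1 - f1 + f1 * (expR x)%:C)
  /\
  ((forall k : nat, (1 <= k <= q)%N -> 1 <= elsym k B / elsym k A) ->
   forall x : R, 0 <= x ->
     hyperF A B x%:C <= 1 - f1 + f1 * (expR x)%:C).
Proof.
move=> f1.
(* The hypotheses start at [k = 1]; the value [1] at [k = 0] supplies the leading coefficient of the
   expansion. *)
have e_ge0 (v : 'I_q -> R[i]) :
    (forall k : nat, (1 <= k <= q)%N -> 0 <= elsym k v) ->
    forall k : nat, (k <= q)%N -> 0 <= elsym k v.
  by move=> v_ge0 [|k] kq; [rewrite elsym0 | apply: v_ge0].
have eA_gt0 k : (k <= q)%N -> 0 < elsym k A.
  move=> kq; rewrite lt_def e_ge0// andbT.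
  by case: k kq => [|k] kq; [rewrite elsym0 oner_eq0 | apply: eA_neq0].
pose rho := term_ratio A B.
have rho_ge0 m : 0 <= rho m by apply: term_ratio_ge0 => // *; apply: e_ge0.
(* Being nonnegative, [rho m] is real even if the parameters are not, so the problem becomes one
   about a real series. *)
pose r m := complex.Re (rho m).
have rE m : rho m = (r m)%:C by rewrite RRe_real ?ger0_real.
have r_ge0 m : 0 <= r m by rewrite -lecR -rE.
have f1E : f1 = (r 0)%:C.
  by rewrite -rE; apply: eq_bigr => j _; rewrite !addr0.
have le_eAB : (forall k, (1 <= k <= q)%N -> 1 <= elsym k B / elsym k A) ->
    forall k, (k <= q)%N -> elsym k A <= elsym k B.
  move=> eBA_ge1 [|k] kq; first by rewrite !elsym0.
  by rewrite -[leLHS]mul1r -ler_pdivlMr ?eA_gt0// eBA_ge1.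
have hyperE x : 0 <= x -> (forall m, r m <= 1) ->
    hyperF A B x%:C =
    (limn (series (fun n => (\prod_(m < n) r m) * exp_coeff x n)))%:C.
  move=> x_ge0 r_le1; apply: lim_series_complex; first exact: cvg_series_ratio.
  move=> n; rewrite hyp_termE rmorphM rmorph_prod /=.
  congr (_ * _); first by apply: eq_bigr => m _; rewrite -rE.
  by rewrite /exp_coeff /= fmorph_div rmorphXn rmorph_nat.
(* The bound on [r] is returned as well, because the lower estimate needs it to apply [hyperE]. *)
have upper : (forall k, (1 <= k <= q)%N -> 1 <= elsym k B / elsym k A) ->
    forall x : R, 0 <= x -> (forall m, r m <= 1) /\
      hyperF A B x%:C <= 1 - f1 + f1 * (expR x)%:C.
  move=> eBA_ge1 x x_ge0.
  have r_le1 m : r m <= 1.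
    rewrite -lecR -rE; apply: term_ratio_le1 => //; first exact: e_ge0.
    exact: le_eAB.
  split=> //; rewrite hyperE// f1E -rmorphM -rmorphB -rmorphD /= lecR.
  exact: lim_series_ratio_le.
split=> [eBA_mono eBA1_ge1 x x_ge0 | eBA_ge1 x x_ge0]; last first.
  by case: (upper eBA_ge1 x x_ge0).
have eBA_le k l : (1 <= k <= l)%N -> (l <= q)%N ->
    elsym k B / elsym k A <= elsym l B / elsym l A.
  case/andP=> k1; elim: l => [|l IHl]; first by rewrite leqNgt k1.
  rewrite leq_eqVlt => /predU1P[-> // | kl] lq.
  apply: le_trans (IHl kl (ltnW lq)) _.
  by apply: eBA_mono; rewrite lq andbT (leq_trans k1).
have eBA_ge1 k : (1 <= k <= q)%N -> 1 <= elsym k B / elsym k A.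
  case: k => // k kq; apply: le_trans eBA1_ge1 _.
  exact: eBA_le.
case: (upper eBA_ge1 x x_ge0) => r_le1 ?; split=> //.
have r_ge m : r 0 <= r m.
  rewrite -lecR -!rE; apply: term_ratio_ge_first => //; first exact: e_ge0.
  move=> k kq; rewrite [leLHS]mulrC -ler_pdivlMr ?eA_gt0//.
  rewrite mulrAC -ler_pdivrMr ?eA_gt0//.
  (* The goal is now that the fraction at [k] is at most the one at [q]. For [k = 0] the former is
     [1], which is where the final [1] of the chain enters. *)
  case: k kq => [_ | k kq]; last exact: eBA_le.
  by rewrite !elsym0 divr1 eBA_ge1 ?q_ge1 /=.
(* The argument [f1 * x%:C] is real, so the trigonometric factor of [cexp] is [1]. *)
rewrite hyperE// f1E -rmorphM /cexp /= cos0 sin0 mulr1 lecR.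
exact: lim_series_ratio_ge.
Qed.
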